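(* Let $d$ be a positive integer, let $\epsilon,\delta>0$, and let $k=d/(4\epsilon^2\delta)$. Then for every $n>d^k$ that is a power of $d$, every string $s\in[0,1]^n$ is $(d,\epsilon,\delta)$-locally-repetitive.
   Context: For a string $s$ of real numbers, $x_s$ denotes the average of its entries. Repetitive string: let $n$ be a multiple of $d$. A string $s\in[0,1]^n$, viewed as a concatenation of $d$ consecutive substrings $s(1),\dots,s(d)$, each of length $n/d$, is $(d,\epsilon)$-repetitive if $|x_s-x_{s(i)}|\le\epsilon$ for every $i\in\{1,\dots,d\}$. $d$-sampling: let $n=d^K$. A $d$-sampling of a string $s\in[0,1]^n$ proceeds as follows: a level $\ell$ is chosen uniformly at random from $\{0,\dots,K-1\}$; then $s$ is partitioned into $d^\ell$ consecutive substrings, each of length $d^{K-\ell}$; then one of these substrings is chosen uniformly at random and is the result of the sampling. Locally-repetitive string: for $n$ a power of $d$, a string $s\in[0,1]^n$ is $(d,\epsilon,\delta)$-locally-repetitive if with probability at least $1-\delta$ a random substring of $s$ sampled using $d$-sampling is $(d,\epsilon)$-repetitive. *)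

(* Defs.v *)
From HB Require Import structures.
From mathcomp Require Import all_boot all_order all_algebra.
From mathcomp Require Import all_classical all_reals all_analysis.

Set Implicit Arguments.
Unset Strict Implicit.
Unset Printing Implicit Defensive.

Import Order.TTheory GRing.Theory Num.Theory.

Local Open Scope ring_scope.

Definition average (R : realType) (s : seq R) : R :=
  (\sum_(x <- s) x) / (size s)%:R.

(* The [i]-th (from 0) consecutive block of length [m] of [s]. *)
Definition block (R : realType) (m i : nat) (s : seq R) : seq R :=
  take m (drop (i * m)%N s).

Definition repetitive (R : realType) (d : nat) (eps : R) (s : seq R) : bool :=
  (d %| size s)%N &&
  [forall i : 'I_d,
     `|average s - average (block (size s %/ d) i s)| <= eps].

(* Probability that the outcome of d-sampling a string [s] of length [d ^ K]
   satisfies [P]: the level [l] is uniform on {0, ..., K - 1} and, given [l],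
   the block is uniform among the [d ^ l] blocks of length [d ^ (K - l)].
   [K] is a parameter because the length does not determine it when [d = 1];
   for [K = 0] there is no level to choose and the value is 0. *)
Definition sampling_prob (R : realType) (d K : nat) (s : seq R)
    (P : pred (seq R)) : R :=
  \sum_(l < K) K%:R^-1 *
    \sum_(j < d ^ l) (d ^ l)%:R^-1 * (P (block (d ^ (K - l)) j s))%:R.

Definition locally_repetitive (R : realType) (d K : nat) (eps delta : R)
    (s : seq R) : Prop :=
  size s = (d ^ K)%N /\ 1 - delta <= sampling_prob d K s (repetitive d eps).

(* Main.v *)
Require Import Defs.
From HB Require Import structures.
From mathcomp Require Import all_boot all_order all_algebra.
From mathcomp Require Import all_classical all_reals all_analysis.
From mathcomp Require Import ring lra.

Set Implicit Arguments.
Unset Strict Implicit.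
Unset Printing Implicit Defensive.

Import Order.TTheory GRing.Theory Num.Theory.

Local Open Scope ring_scope.

(** Energy increment. Let [E l] be the mean of the squared averages of the
    [d ^ l] blocks of level [l]. Since the average of a block is the mean of
    the averages of its [d] children, [E (l + 1) - E l] is the mean over the
    blocks of the variance of the averages of their children; a block that is
    not repetitive contributes a variance of at least [eps ^ 2 / d]. The
    increments telescope to at most [mu - mu ^ 2 <= 1 / 4], where [mu] is the
    average of [s], so the fraction of non-repetitive blocks is at most
    [d / (4 * eps ^ 2 * K) <= delta]. *)

Lemma block_drop (R : realType) (m i : nat) (s : seq R) :
  block m i (drop m s) = block m i.+1 s.
Proof. by rewrite /block drop_drop mulSn addnC. Qed.

Lemma size_block (R : realType) (m i : nat) (s : seq R) :
  (i.+1 * m <= size s)%N -> size (block m i s) = m.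
Proof.
move=> h; rewrite /block size_takel// size_drop leq_subRL.
  by rewrite addnC -mulSn.
by apply: leq_trans h; rewrite leq_mul2r leqnSn orbT.
Qed.

(** Since [i < d], the outer window of length [d * m] does not truncate the inner one. This
    identifies the children of a block with blocks of the next level. *)
Lemma block_block (R : realType) (d m i j : nat) (s : seq R) : (i < d)%N ->
  block m i (block (d * m) j s) = block m (j * d + i) s.
Proof.
move=> id; have h : (m + i * m <= d * m)%N by rewrite -mulSn leq_mul2r id orbT.
have h' : (i * m <= d * m)%N := leq_trans (leq_addl m _) h.
rewrite /block -[X in take X (drop (j * _) s)](subnK h').
rewrite -take_drop drop_drop take_takel; last by rewrite leq_subRL// addnC.
by rewrite mulnDl mulnA addnC.
Qed.

Lemma sum_blocks (R : realType) (d m : nat) (s : seq R) : size s = (d * m)%N ->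
  \sum_(x <- s) x = \sum_(i < d) \sum_(x <- block m i s) x.
Proof.
elim: d s => [|d IH] s hs.
  by rewrite big_ord0 (size0nil hs) big_nil.
rewrite big_ord_recl -[in LHS](cat_take_drop m s) big_cat /=.
rewrite {1}/block mul0n drop0; congr (_ + _).
rewrite IH; last by rewrite size_drop hs mulSn addKn.
by apply: eq_bigr => i _; rewrite block_drop.
Qed.

Lemma average_blocks (R : realType) (d m : nat) (s : seq R) :
  size s = (d * m)%N ->
  average s = d%:R^-1 * \sum_(i < d) average (block m i s).
Proof.
move=> hs; rewrite /average (sum_blocks hs) hs.
under [in RHS]eq_bigr => i _.
  rewrite size_block; last by rewrite hs leq_mul2r ltn_ord orbT.
  over.
by rewrite -big_distrl/= natrM invfM mulrCA mulrA.
Qed.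

Lemma average_itv (R : realType) (s : seq R) :
  (forall x, x \in s -> 0 <= x <= 1) -> 0 <= average s <= 1.
Proof.
move=> hs; rewrite /average; case: (posnP (size s)) => [->|s0].
  (* For the empty string the average is 0, because the inverse of 0 is 0 by convention. *)
  by rewrite invr0 mulr0 lexx ler01.
rewrite ler_pdivrMr ?ltr0n// mul1r divr_ge0 //=.
  rewrite -sum1_size natr_sum big_seq [leRHS]big_seq; apply: ler_sum => x.
  by move=> /hs/andP[].
by rewrite big_seq; apply: sumr_ge0 => x /hs/andP[].
Qed.

Lemma variance_mean (R : realType) (d : nat) (x : 'I_d -> R) (mu : R) :
  (0 < d)%N -> mu = d%:R^-1 * \sum_i x i ->
  d%:R^-1 * \sum_i (x i) ^+ 2 - mu ^+ 2 = d%:R^-1 * \sum_i (mu - x i) ^+ 2.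
Proof.
move=> d0 hmu; have dn0 : d%:R != 0 :> R by rewrite pnatr_eq0 -lt0n.
have hs : \sum_i x i = d%:R * mu by rewrite hmu mulVKf.
have -> : \sum_i (mu - x i) ^+ 2
    = \sum_i (x i) ^+ 2 - mu *+ 2 * \sum_i x i + d%:R * mu ^+ 2.
  have -> : d%:R * mu ^+ 2 = \sum_(i < d) mu ^+ 2.
    by rewrite sumr_const card_ord mulr_natl.
  rewrite mulr_sumr -sumrB -big_split/=.
  by apply: eq_bigr => i _; ring.
by rewrite hs; field.
Qed.

(** A single [x i] farther than [eps] from [mu] contributes more than [eps ^+ 2 / d%:R] to the
    variance, and the other terms are nonnegative. Writing the case distinction as a 0/1 factor lets
    the bound be summed over all blocks of a level. *)
Lemma variance_lower_bound (R : realType) (d : nat) (x : 'I_d -> R) (mu : R)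
    (eps : R) : (0 < d)%N -> 0 < eps -> mu = d%:R^-1 * \sum_i x i ->
  (~~ [forall i, `|mu - x i| <= eps])%:R * (eps ^+ 2 / d%:R)
    <= d%:R^-1 * \sum_i (x i) ^+ 2 - mu ^+ 2.
Proof.
move=> d0 heps hmu; rewrite (variance_mean d0 hmu).
case: (boolP [forall i, _]) => [_|/forallPn [i hi]] /=.
  rewrite mul0r mulr_ge0 ?invr_ge0//; apply: sumr_ge0 => i _; exact: sqr_ge0.
rewrite mul1r mulrC ler_pM2l ?invr_gt0 ?ltr0n// (bigD1 i)//=.
rewrite -[leLHS]addr0 lerD//; last by apply: sumr_ge0 => j _; exact: sqr_ge0.
rewrite -[leRHS]real_normK ?num_real// lerXn2r ?nnegrE ?(ltW heps)//.
by rewrite ltW// ltNge.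
Qed.

Definition energy (R : realType) (d K l : nat) (s : seq R) : R :=
  (d ^ l)%:R^-1 * \sum_(j < d ^ l) average (block (d ^ (K - l)) j s) ^+ 2.

(** Quotient and remainder of a block index by [d] give the parent block and the rank among its
    children. *)
Lemma sum_children (R : realType) (n d : nat) (F : nat -> R) :
  \sum_(j < n * d) F j = \sum_(j < n) \sum_(i < d) F (j * d + i)%N.
Proof.
rewrite -(big_mkord xpredT F) big_nat_mul big_mkord; apply: eq_bigr => j _.
rewrite -[X in index_iota X _]add0n big_addn mulSn addnK big_mkord.
by apply: eq_bigr => i _; rewrite addnC.
Qed.

Lemma size_level_block (R : realType) (d K l : nat) (s : seq R)
    (j : 'I_(d ^ l)) : size s = (d ^ K)%N -> (l <= K)%N ->
  size (block (d ^ (K - l)) j s) = (d ^ (K - l))%N.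
Proof.
move=> hs lK; rewrite size_block// hs -[in leqRHS](subnKC lK) expnD.
by rewrite leq_mul2r ltn_ord orbT.
Qed.

Lemma energy_increment (R : realType) (d K l : nat) (s : seq R) (eps : R) :
  (0 < d)%N -> 0 < eps -> size s = (d ^ K)%N -> (l < K)%N ->
  (d ^ l)%:R^-1 * \sum_(j < d ^ l)
     (~~ repetitive d eps (block (d ^ (K - l)) j s))%:R * (eps ^+ 2 / d%:R)
  <= energy d K l.+1 s - energy d K l s.
Proof.
move=> d0 heps hs lK; rewrite /energy.
have -> : (d ^ l.+1)%:R^-1 * \sum_(j < d ^ l.+1)
      average (block (d ^ (K - l.+1)) j s) ^+ 2
    = (d ^ l)%:R^-1 * \sum_(j < d ^ l) d%:R^-1 * \sum_(i < d)
      average (block (d ^ (K - l.+1)) i (block (d ^ (K - l)) j s)) ^+ 2.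
  rewrite expnSr natrM invfM -mulrA -mulr_sumr; congr (_ * (_ * _)).
  rewrite (@sum_children R _ _ (fun j => average (block _ j s) ^+ 2)).
  apply: eq_bigr => j _; apply: eq_bigr => i _.
  by rewrite -[(K - l)%N in RHS]subnSK// expnS block_block.
rewrite -mulrBr -sumrB ler_wpM2l ?invr_ge0//; apply: ler_sum => j _.
have hsz := size_level_block j hs (ltnW lK).
set b := block _ j s in hsz *.
have hsd : size b = (d * d ^ (K - l.+1))%N by rewrite hsz -expnS subnSK.
(* As [l < K], the block length is a multiple of [d], so only the condition on the averages of the
   children remains in [repetitive]. *)
rewrite /repetitive {1}hsd dvdn_mulr//= hsd mulKn//.
by apply: variance_lower_bound => //; exact: average_blocks.
Qed.

(** Block averages lie in [0, 1], where squaring does not increase, and their mean is [average s].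
    Bounding by [average s] instead of 1 is what yields the factor 4 in the final estimate. *)
Lemma energy_le_average (R : realType) (d K l : nat) (s : seq R) :
  size s = (d ^ K)%N -> (l <= K)%N -> (forall x, x \in s -> 0 <= x <= 1) ->
  energy d K l s <= average s.
Proof.
move=> hs lK h01; rewrite (@average_blocks _ (d ^ l) (d ^ (K - l))); last first.
  by rewrite -expnD subnKC.
rewrite ler_wpM2l ?invr_ge0//; apply: ler_sum => j _.
have /andP[a0 a1] : 0 <= average (block (d ^ (K - l)) j s) <= 1.
  by apply: average_itv => x /mem_take/mem_drop/h01.
by rewrite expr2 ler_piMr.
Qed.

Lemma energy0 (R : realType) (d K : nat) (s : seq R) :
  size s = (d ^ K)%N -> energy d K 0 s = average s ^+ 2.
Proof.
move=> hs; rewrite /energy expn0 invr1 mul1r big_ord1 subn0 /block mul0n drop0.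
by rewrite -hs take_size.
Qed.

Lemma sampling_prob_lower_bound (R : realType) (d K : nat) (eps : R)
    (s : seq R) : (0 < d)%N -> (0 < K)%N -> 0 < eps -> size s = (d ^ K)%N ->
  (forall x, x \in s -> 0 <= x <= 1) ->
  1 - d%:R / (4 * eps ^+ 2 * K%:R) <= sampling_prob d K s (repetitive d eps).
Proof.
move=> d0 K0 heps hs h01.
have hd : 0 < d%:R :> R by rewrite ltr0n.
have hK : 0 < K%:R :> R by rewrite ltr0n.
set c := d%:R / eps ^+ 2.
have c0 : 0 < c by rewrite divr_gt0 ?exprn_gt0.
(* Dividing the energy increment bound by [eps ^+ 2 / d%:R], the inverse of [c], bounds the fraction
   of non-repetitive blocks of level [l]; the complement is the fraction of repetitive ones. *)
have hlevel (l : 'I_K) : 1 - c * (energy d K l.+1 s - energy d K l s) <=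
    \sum_(j < d ^ l) (d ^ l)%:R^-1 *
      (repetitive d eps (block (d ^ (K - l)) j s))%:R.
  have := energy_increment d0 heps hs (ltn_ord l).
  rewrite -mulr_suml (mulrA (d ^ l)%:R^-1) -ler_pdivlMr ?divr_gt0 ?exprn_gt0// invf_div.
  rewrite -/c [_ * c]mulrC => hle; rewrite lerBlDr -lerBlDl (le_trans _ hle)//.
  rewrite -mulr_sumr lerBlDl -mulrDr -big_split/=.
  rewrite (eq_bigr (fun=> 1)) => [|j _]; last first.
    by rewrite -natrD; case: repetitive.
  by rewrite sumr_const card_ord mulVf// pnatr_eq0 -lt0n expn_gt0 d0.
rewrite /sampling_prob -mulr_sumr.
apply: (@le_trans _ _ (K%:R^-1 *
  \sum_(l < K) (1 - c * (energy d K l.+1 s - energy d K l s)))); last first.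
  by rewrite ler_wpM2l ?invr_ge0 ?ler_sum.
rewrite sumrB sumr_const card_ord -mulr_sumr mulrBr mulVf ?gt_eqF//.
rewrite -(big_mkord xpredT (fun l => energy d K l.+1 s - energy d K l s)).
rewrite telescope_sumr// lerD2l lerN2.
have -> : d%:R / (4 * eps ^+ 2 * K%:R) = K%:R^-1 * (c * 4^-1).
  by rewrite /c; field; rewrite !gt_eqF.
rewrite ler_pM2l ?invr_gt0// ler_pM2l// (energy0 hs).
apply: (@le_trans _ _ (average s - average s ^+ 2)).
  by rewrite lerD2r energy_le_average.
(* With [a] the average, [a - a ^+ 2 <= 1 / 4] is the nonnegativity of the square of [a - 1 / 2]. *)
have := sqr_ge0 (average s - 2^-1); lra.
Qed.

Theorem lemma11 (R : realType) (d : nat) (eps delta k : R)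
    (hd : (0 < d)%N) (heps : 0 < eps) (hdelta : 0 < delta)
    (hk : k = d%:R / (4 * eps ^+ 2 * delta))
    (n K : nat) (hn : n = (d ^ K)%N) (hnk : d%:R `^ k < n%:R)
    (s : n.-tuple R) (hs : forall x : R, x \in s -> 0 <= x <= 1) :
  locally_repetitive d K eps delta s.
Proof.
have hsz : size s = (d ^ K)%N by rewrite size_tuple.
have e0 : 0 < 4 * eps ^+ 2 by rewrite mulr_gt0 ?exprn_gt0.
(* Powers of [d >= 1] are monotone in the exponent, so [K <= k] would contradict [hnk]. For [d = 1],
   [hnk] itself reads [1 < 1]. *)
have kK : k < K%:R.
  rewrite ltNge; apply/negP => Kk; move: hnk.
  rewrite hn natrX -powR_mulrn ?ler0n// ltNge ler_powR// ler1n//.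
have k0 : 0 < k by rewrite hk divr_gt0 ?ltr0n// mulr_gt0.
have K0 : 0 < K%:R :> R by apply: lt_trans kK.
split=> //; apply: le_trans (sampling_prob_lower_bound hd _ heps hsz hs) => //.
  (* By the formula for [k], the bound [k <= K] rearranges to [d / (4 * eps ^+ 2 * K) <= delta]: [K]
     and [delta] trade places. *)
  rewrite lerD2l lerN2 ler_pdivrMr ?mulr_gt0// mulrCA mulrA.
  by move: (ltW kK); rewrite hk ler_pdivrMr ?mulr_gt0// mulrC.
by rewrite -(ltr0n R).
Qed.
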